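(* Writing $N_{A_l}:=N_{G^{dual+}_{A_l}}$ etc., the following hold. For all $l\ge1$, \[ (l+3)N_{A_{l+2}}(t) = -(2l+3)(2t-1) N_{A_{l+1}}(t) - l\, N_{A_l}(t). \] For all $l\ge2$, \[ (l+2)N_{B_{l+2}}(t) = -(2l+3)\Big\{2t-\frac{2(2l^2+4l+1)}{(2l+1)(2l+3)}\Big\} N_{B_{l+1}}(t) - \frac{l(2l+3)}{2l+1}N_{B_{l}}(t). \] For all $l\ge4$, \[ N_{D_{l+3}}(t) = (a_{l} + b_{l} t) N_{D_{l+2}}(t) +(c_{l} + d_{l} t + e_{l} t^2) N_{D_{l+1}}(t) + (f_{l} + g_{l} t) N_{D_l}(t), \] where, with $Q_l:=(l+3)(43l^3-35l^2-36l-32)$, $a_l=\frac{(l+2)(43l^3-78l^2-129l-24)}{Q_l}$, $b_l=-\frac{86l^4+145l^3-196l^2-623l-456}{Q_l}$, $c_l=\frac{l(43l^3+180l^2+45l+56)}{Q_l}$, $d_l=-\frac{2l(172l^3+333l^2-23l-32)}{Q_l}$, $e_l=\frac{2(2l-1)(2l+1)(43l^2+51l-24)}{Q_l}$, $f_l=-\frac{(l-1)(43l^3+137l^2+38l-48)}{Q_l}$, $g_l=\frac{(l-1)(2l+1)(43l^2+51l-24)}{Q_l}$.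
   Context: For a finite Coxeter type $P$ with Coxeter system $(W,S)$, set of reflections $T$, reflection length $\ell_T$, order $g\le_T h\iff \ell_T(g)+\ell_T(g^{-1}h)=\ell_T(h)$, and bipartite Coxeter element $c$, the dual Artin monoid $G^{dual+}_P$ is the monoid generated by $T$ with relations $r\cdot s=(rsr^{-1})\cdot r$ for all $r,s\in T$ with $rs\le_T c$; it is graded by word length $\deg$ and is a lattice for left divisibility. Its skew-growth function is $N_{G^{dual+}_P}(t)=\sum_{J\subseteq T}(-1)^{|J|}t^{\deg(\mathrm{lcm}(J))}$. It is known that $N_{G^{dual +}_{A_l}}(t)=\sum_{k=0}^{l} (-1)^{k}\frac{1}{l}\binom {l}{k}\binom {l+k}{k+1}t^k$ ($l\ge1$), $N_{G^{dual +}_{B_l}}(t)=\sum_{k=0}^{l} (-1)^{k}\binom {l}{k}\binom {l+k-1}{k}t^k$ ($l\ge2$), $N_{G^{dual +}_{D_l}}(t)=\sum_{k=0}^{l} (-1)^{k} \big( \binom {l}{k}\binom {l+k-2}{k} + \binom {l-2}{k-2}\binom {l+k-3}{k}\big) t^k$ ($l\ge4$). *)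

(* Defs.v *)
From HB Require Import structures.
From mathcomp Require Import all_boot all_order all_algebra.
From mathcomp Require Import finmap.
From mathcomp Require Import boolp classical_sets fsbigop.

Set Implicit Arguments.
Unset Strict Implicit.
Unset Printing Implicit Defensive.

Import GRing.Theory.

(* The least congruence on the free monoid [seq A] containing [R]. *)
Inductive word_congr (A : choiceType) (R : seq A -> seq A -> Prop) :
    seq A -> seq A -> Prop :=
| WordRel u v x y : R x y -> word_congr R (u ++ x ++ v) (u ++ y ++ v)
| WordRefl u : word_congr R u u
| WordSym u v : word_congr R u v -> word_congr R v u
| WordTrans u v w : word_congr R u v -> word_congr R v w -> word_congr R u w.

Definition word_eqb (A : choiceType) (R : seq A -> seq A -> Prop) : rel (seq A) :=
  fun u v => `[< word_congr R u v >].

Lemma word_eqb_refl (A : choiceType) (R : seq A -> seq A -> Prop) :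
  reflexive (word_eqb R).
Proof. by move=> u; apply/asboolP; apply: WordRefl. Qed.

Lemma word_eqb_sym (A : choiceType) (R : seq A -> seq A -> Prop) :
  symmetric (word_eqb R).
Proof. by move=> u v; apply/asboolP/asboolP => h; apply: WordSym. Qed.

Lemma word_eqb_trans (A : choiceType) (R : seq A -> seq A -> Prop) :
  transitive (word_eqb R).
Proof.
by move=> v u w /asboolP h1 /asboolP h2; apply/asboolP; apply: WordTrans h1 h2.
Qed.

Canonical word_equiv (A : choiceType) (R : seq A -> seq A -> Prop) :=
  EquivRel (word_eqb R) (@word_eqb_refl A R) (@word_eqb_sym A R)
    (@word_eqb_trans A R).

Local Open Scope quotient_scope.

Definition presented (A : choiceType) (R : seq A -> seq A -> Prop) : Type :=
  {eq_quot word_equiv R}.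

HB.instance Definition _ (A : choiceType) (R : seq A -> seq A -> Prop) :=
  Choice.on (presented R).

Definition of_word (A : choiceType) (R : seq A -> seq A -> Prop) (u : seq A) :
  presented R := \pi_({eq_quot word_equiv R}) u.

Definition to_word (A : choiceType) (R : seq A -> seq A -> Prop)
  (x : presented R) : seq A := repr (x : {eq_quot word_equiv R}).

Lemma to_wordK (A : choiceType) (R : seq A -> seq A -> Prop) :
  cancel (@to_word A R) (@of_word A R).
Proof. exact: reprK. Qed.

Lemma of_wordP (A : choiceType) (R : seq A -> seq A -> Prop) (u v : seq A) :
  of_word R u = of_word R v <-> word_congr R u v.
Proof.
rewrite /of_word; split=> [/eqquotP /asboolP //|h].
by apply/eqquotP/asboolP.
Qed.

Lemma word_congr_cat (A : choiceType) (R : seq A -> seq A -> Prop)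
    (u u' v v' : seq A) :
  word_congr R u u' -> word_congr R v v' -> word_congr R (u ++ v) (u' ++ v').
Proof.
move=> hu hv; apply: (@WordTrans _ _ _ (u' ++ v)).
  elim: hu => {u u'} [u w x y r|u|u w _ ih|u w z _ ih1 _ ih2].
  - by rewrite -!catA; apply: WordRel.
  - exact: WordRefl.
  - exact: WordSym.
  - exact: WordTrans ih1 ih2.
elim: hv => {v v'} [v w x y r|v|v w _ ih|v w z _ ih1 _ ih2].
- by rewrite !(catA u'); apply: WordRel.
- exact: WordRefl.
- exact: WordSym.
- exact: WordTrans ih1 ih2.
Qed.

Definition presented_mul (A : choiceType) (R : seq A -> seq A -> Prop)
  (x y : presented R) : presented R := of_word R (to_word x ++ to_word y).

Lemma presented_mulE (A : choiceType) (R : seq A -> seq A -> Prop)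
    (u v : seq A) :
  presented_mul (of_word R u) (of_word R v) = of_word R (u ++ v).
Proof.
by apply/of_wordP; apply: word_congr_cat; apply/of_wordP; rewrite to_wordK.
Qed.

Lemma presented_mulA (A : choiceType) (R : seq A -> seq A -> Prop) :
  associative (@presented_mul A R).
Proof.
move=> x y z; rewrite -(to_wordK x) -(to_wordK y) -(to_wordK z).
by rewrite !presented_mulE catA.
Qed.

Lemma presented_mul1 (A : choiceType) (R : seq A -> seq A -> Prop) :
  left_id (of_word R [::]) (@presented_mul A R).
Proof. by move=> x; rewrite -(to_wordK x) presented_mulE. Qed.

Lemma presented_1mul (A : choiceType) (R : seq A -> seq A -> Prop) :
  right_id (of_word R [::]) (@presented_mul A R).
Proof. by move=> x; rewrite -(to_wordK x) presented_mulE cats0. Qed.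

HB.instance Definition _ (A : choiceType) (R : seq A -> seq A -> Prop) :=
  isMonoid.Build (presented R)
    (@presented_mulA A R) (@presented_mul1 A R) (@presented_1mul A R).

(* The entry 0 stands for infinity. *)
Record coxeter_matrix (n : nat) := CoxeterMatrix {
  cox_entry :> 'I_n -> 'I_n -> nat;
  cox_diag : forall i, cox_entry i i = 1;
  cox_sym : forall i j, cox_entry i j = cox_entry j i;
  cox_offdiag : forall i j, i != j -> cox_entry i j != 1 }.

(* (s_i s_j)^(m_ij) = 1; since m_ii = 1 this includes s_i^2 = 1, so the monoid
   with this presentation is the Coxeter group. *)
Inductive coxeter_rel (n : nat) (M : coxeter_matrix n) :
    seq 'I_n -> seq 'I_n -> Prop :=
| CoxeterRel i j : coxeter_rel M (flatten (nseq (M i j) [:: i; j])) [::].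

Definition coxeter_group (n : nat) (M : coxeter_matrix n) : Type :=
  presented (coxeter_rel M).

HB.instance Definition _ (n : nat) (M : coxeter_matrix n) :=
  Monoid.on (coxeter_group M).

Local Open Scope group_scope.

Definition coxeter_inv (n : nat) (M : coxeter_matrix n)
  (x : coxeter_group M) : coxeter_group M :=
  of_word (coxeter_rel M) (rev (to_word x)).

Lemma of_wordM (A : choiceType) (R : seq A -> seq A -> Prop) (u v : seq A) :
  of_word R (u ++ v) = of_word R u * of_word R v.
Proof. by rewrite -presented_mulE. Qed.

Lemma coxeter_square (n : nat) (M : coxeter_matrix n) (i : 'I_n) :
  of_word (coxeter_rel M) [:: i; i] = 1.
Proof.
apply/of_wordP; have := WordRel [::] [::] (CoxeterRel M i i).
by rewrite cox_diag.
Qed.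

Lemma coxeter_mul_rev (n : nat) (M : coxeter_matrix n) (u : seq 'I_n) :
  of_word (coxeter_rel M) (rev u ++ u) = 1.
Proof.
elim: u => [//|i u ih].
rewrite rev_cons cat_rcons -[i :: i :: u]/([:: i; i] ++ u) !of_wordM.
by rewrite coxeter_square mul1g -of_wordM.
Qed.

Lemma coxeter_mulVg (n : nat) (M : coxeter_matrix n) :
  left_inverse 1 (@coxeter_inv n M) *%g.
Proof.
move=> x; rewrite /coxeter_inv -[X in _ * X]to_wordK -of_wordM.
exact: coxeter_mul_rev.
Qed.

Lemma coxeter_mulgV (n : nat) (M : coxeter_matrix n) :
  right_inverse 1 (@coxeter_inv n M) *%g.
Proof.
move=> x; rewrite /coxeter_inv -[X in X * _]to_wordK -of_wordM.
by rewrite -[X in X ++ _]revK; apply: coxeter_mul_rev.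
Qed.

HB.instance Definition _ (n : nat) (M : coxeter_matrix n) :=
  hasInv.Build (coxeter_group M) (@coxeter_inv n M).

HB.instance Definition _ (n : nat) (M : coxeter_matrix n) :=
  Monoid_isGroup.Build (coxeter_group M)
    (@coxeter_mulVg n M) (@coxeter_mulgV n M).

Definition simple_refl (n : nat) (M : coxeter_matrix n) (i : 'I_n) :
  coxeter_group M := of_word (coxeter_rel M) [:: i].

Definition is_reflection (n : nat) (M : coxeter_matrix n) :
  pred (coxeter_group M) :=
  fun t => `[< exists (i : 'I_n) (w : coxeter_group M),
                 t = w * simple_refl M i * w^-1 >].

Definition reflection (n : nat) (M : coxeter_matrix n) : Type :=
  {t : coxeter_group M | is_reflection t}.

HB.instance Definition _ (n : nat) (M : coxeter_matrix n) :=
  Choice.on (reflection M).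

Definition prod_of_reflections (n : nat) (M : coxeter_matrix n)
  (w : coxeter_group M) : pred nat :=
  fun k => `[< exists ts : k.-tuple (reflection M),
                 w = \prod_(t <- ts) sval t >].

Lemma prod_of_reflections_ex (n : nat) (M : coxeter_matrix n)
  (w : coxeter_group M) : exists k, prod_of_reflections w k.
Proof.
rewrite -(to_wordK w); elim: (to_word w) => [|i u [k /asboolP[ts E]]].
  by exists 0; apply/asboolP; exists [tuple]; rewrite big_nil.
have ri : is_reflection (simple_refl M i).
  by apply/asboolP; exists i, 1; rewrite mul1g invg1 mulg1.
exists k.+1; apply/asboolP.
exists [tuple of (exist _ (simple_refl M i) ri : reflection M) :: ts].
by rewrite big_cons -E -of_wordM.
Qed.

Definition reflection_length (n : nat) (M : coxeter_matrix n)
  (w : coxeter_group M) : nat := ex_minn (prod_of_reflections_ex w).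

Definition abs_le (n : nat) (M : coxeter_matrix n) (g h : coxeter_group M) :
  Prop :=
  (reflection_length g + reflection_length (g^-1 * h)%g)%N = reflection_length h.

(* S is split into two classes of pairwise commuting simple reflections. *)
Definition bipartite_coxeter_element (n : nat) (M : coxeter_matrix n)
  (c : coxeter_group M) : Prop :=
  exists b : 'I_n -> bool,
    (forall i j, i != j -> b i = b j -> M i j = 2) /\
    c = (\prod_(i | b i) simple_refl M i) * (\prod_(i | ~~ b i) simple_refl M i).

Inductive dual_rel (n : nat) (M : coxeter_matrix n) (c : coxeter_group M) :
    seq (reflection M) -> seq (reflection M) -> Prop :=
| DualRel (r s r' : reflection M) :
    sval r' = sval r * sval s * (sval r)^-1 -> abs_le (sval r * sval s) c ->
    dual_rel c [:: r; s] [:: r'; r].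

Definition dual_artin_monoid (n : nat) (M : coxeter_matrix n)
  (c : coxeter_group M) : Type := presented (dual_rel c).

HB.instance Definition _ (n : nat) (M : coxeter_matrix n)
  (c : coxeter_group M) := Monoid.on (dual_artin_monoid c).

Definition dual_gen (n : nat) (M : coxeter_matrix n) (c : coxeter_group M)
  (t : reflection M) : dual_artin_monoid c := of_word (dual_rel c) [:: t].

(* The defining relations preserve the length of words, so the choice of the
   representative is irrelevant. *)
Definition dual_deg (n : nat) (M : coxeter_matrix n) (c : coxeter_group M)
  (x : dual_artin_monoid c) : nat := size (to_word x).

Lemma dual_congr_size (n : nat) (M : coxeter_matrix n) (c : coxeter_group M)
  (u v : seq (reflection M)) : word_congr (dual_rel c) u v -> size u = size v.
Proof.
elim=> // {u v} [u v x y [r s r' _ _]|u v w _ -> _ -> //].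
by rewrite !size_cat.
Qed.

Lemma dual_deg_of_word (n : nat) (M : coxeter_matrix n) (c : coxeter_group M)
  (u : seq (reflection M)) : dual_deg (of_word (dual_rel c) u) = size u.
Proof. by apply: (@dual_congr_size _ _ c); apply/of_wordP; rewrite to_wordK. Qed.

Definition left_divides (G : monoidType) (x y : G) : Prop :=
  exists z : G, y = x * z.

Definition is_lcm (G : monoidType) (X : set G) (m : G) : Prop :=
  (forall x, X x -> left_divides x m) /\
  (forall m', (forall x, X x -> left_divides x m') -> left_divides m m').

(* The element 1 is returned when [X] has no least common multiple. *)
Definition monoid_lcm (G : monoidType) (X : set G) : G := xget 1 (is_lcm X).

Local Open Scope ring_scope.
Local Open Scope classical_set_scope.

(* [J] ranges over all finite sets of reflections. For a Coxeter group of finite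
   type these are the subsets of the finite set T, and the sum is finite. *)
Definition skew_growth (n : nat) (M : coxeter_matrix n) (c : coxeter_group M) :
  {poly rat} :=
  \sum_(J \in [set: {fset reflection M}])
     ((-1) ^+ #|` J| *: 'X^(dual_deg (monoid_lcm [set dual_gen c t | t in [set` J]]))
      : {poly rat}).

Local Close Scope classical_set_scope.
Local Close Scope ring_scope.
Local Close Scope group_scope.

(* Path 0 - 1 - ... - (l-1). *)
Definition entryA (l : nat) (i j : 'I_l) : nat :=
  if i == j then 1 else if (minn i j).+1 == maxn i j then 3 else 2.

(* Same path, whose last edge is labelled 4. *)
Definition entryB (l : nat) (i j : 'I_l) : nat :=
  if i == j then 1 else
  if (minn i j).+1 == maxn i j then (if (maxn i j).+1 == l then 4 else 3)
  else 2.

(* Path 0 - 1 - ... - (l-2), with the vertex l-1 attached to l-3. *)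
Definition entryD (l : nat) (i j : 'I_l) : nat :=
  if i == j then 1 else
  if (if (maxn i j).+1 == l then (minn i j).+2 else (minn i j).+1) == maxn i j
  then 3 else 2.

Program Definition coxeterA (l : nat) : coxeter_matrix l :=
  @CoxeterMatrix l (@entryA l) _ _ _.
Next Obligation. by rewrite /entryA eqxx. Qed.
Next Obligation. by rewrite /entryA eq_sym minnC maxnC. Qed.
Next Obligation. by rewrite /entryA (negbTE H); case: ifP. Qed.

Program Definition coxeterB (l : nat) : coxeter_matrix l :=
  @CoxeterMatrix l (@entryB l) _ _ _.
Next Obligation. by rewrite /entryB eqxx. Qed.
Next Obligation. by rewrite /entryB eq_sym minnC maxnC. Qed.
Next Obligation. by rewrite /entryB (negbTE H); do 2?case: ifP. Qed.

Program Definition coxeterD (l : nat) : coxeter_matrix l :=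
  @CoxeterMatrix l (@entryD l) _ _ _.
Next Obligation. by rewrite /entryD eqxx. Qed.
Next Obligation. by rewrite /entryD eq_sym minnC maxnC. Qed.
Next Obligation. by rewrite /entryD (negbTE H); do 2?case: ifP. Qed.

Local Open Scope ring_scope.

Definition closedA (l : nat) : {poly rat} :=
  \sum_(k < l.+1)
    ((-1) ^+ k * l%:R^-1 * 'C(l, k)%:R * 'C(l + k, k.+1)%:R) *: 'X^k.

Definition closedB (l : nat) : {poly rat} :=
  \sum_(k < l.+1) ((-1) ^+ k * 'C(l, k)%:R * 'C(l + k - 1, k)%:R) *: 'X^k.

(* The binomial coefficient (l-2 choose k-2) is 0 for k < 2; the subtraction of
   natural numbers is truncated, so that case is treated apart. *)
Definition closedD (l : nat) : {poly rat} :=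
  \sum_(k < l.+1)
    ((-1) ^+ k *
     ('C(l, k)%:R * 'C(l + k - 2, k)%:R
      + (if (2 <= k)%N then 'C(l - 2, k - 2)%:R else 0)
        * 'C(l + k - 3, k)%:R)) *: 'X^k.

Definition Qcoef (l : rat) : rat :=
  (l + 3) * (43 * l ^+ 3 - 35 * l ^+ 2 - 36 * l - 32).
Definition acoef (l : rat) : rat :=
  (l + 2) * (43 * l ^+ 3 - 78 * l ^+ 2 - 129 * l - 24) / Qcoef l.
Definition bcoef (l : rat) : rat :=
  - ((86 * l ^+ 4 + 145 * l ^+ 3 - 196 * l ^+ 2 - 623 * l - 456) / Qcoef l).
Definition ccoef (l : rat) : rat :=
  l * (43 * l ^+ 3 + 180 * l ^+ 2 + 45 * l + 56) / Qcoef l.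
Definition dcoef (l : rat) : rat :=
  - (2 * l * (172 * l ^+ 3 + 333 * l ^+ 2 - 23 * l - 32) / Qcoef l).
Definition ecoef (l : rat) : rat :=
  2 * (2 * l - 1) * (2 * l + 1) * (43 * l ^+ 2 + 51 * l - 24) / Qcoef l.
Definition fcoef (l : rat) : rat :=
  - ((l - 1) * (43 * l ^+ 3 + 137 * l ^+ 2 + 38 * l - 48) / Qcoef l).
Definition gcoef (l : rat) : rat :=
  (l - 1) * (2 * l + 1) * (43 * l ^+ 2 + 51 * l - 24) / Qcoef l.

(* Main.v *)
Require Import Defs.
From mathcomp Require Import all_boot all_order all_algebra.
From mathcomp Require Import ring lra zify.

(**
In each family the coefficient of t^k in N_l is a hypergeometric term: up to a
polynomial in l and k it is (-1)^k (l + k)! / (k!^2 (l - k)!). Hence all the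
terms entering the coefficient of t^k of one of the recurrences are polynomial
multiples of one common term, and the recurrence reduces to an identity between
polynomials in l and k. Reading 1 / n! as 0 for n < 0 makes the reduction
uniform in k, boundary cases included.
*)

Set Implicit Arguments.
Unset Strict Implicit.
Unset Printing Implicit Defensive.

Import GRing.Theory Num.Theory.

Local Open Scope ring_scope.

(** * Reciprocal factorials extended by zero *)

(* This is 1 / (m - k)!, read as 0 when [m < k]. *)
Definition inv_fact_sub (m k : nat) : rat := (m ^_ k)%:R / (m`!)%:R.

Lemma fact_rat_neq0 (n : nat) : (n`!)%:R != 0 :> rat.
Proof. by rewrite pnatr_eq0 -lt0n fact_gt0. Qed.

Lemma inv_fact_subE (m k : nat) :
  (k <= m)%N -> inv_fact_sub m k = ((m - k)`!)%:R^-1.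
Proof.
move=> km; rewrite /inv_fact_sub -(ffact_fact km) natrM.
have := fact_rat_neq0 (m - k).
have : (m ^_ k)%:R != 0 :> rat by rewrite pnatr_eq0 -lt0n ffact_gt0.
by move=> ? ?; field; apply/andP.
Qed.

Lemma inv_fact_sub_small (m k : nat) : (m < k)%N -> inv_fact_sub m k = 0.
Proof. by move=> mk; rewrite /inv_fact_sub ffact_small // mul0r. Qed.

Lemma inv_fact_sub0 (m : nat) : inv_fact_sub m 0 = (m`!)%:R^-1.
Proof. by rewrite /inv_fact_sub ffactn0 mul1r. Qed.

(** The rule 1 / (m - k - 1)! = (m - k) / (m - k)! survives the zero convention: at [k = m] the
    factor vanishes, and for [k > m] both reciprocals do. The difference lives in [rat], so nothing
    is truncated. *)
Lemma inv_fact_subSr (m k : nat) :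
  inv_fact_sub m k.+1 = (m%:R - k%:R) * inv_fact_sub m k.
Proof.
rewrite /inv_fact_sub ffactnSr natrM.
have [km|mk] := leqP k m; first by rewrite natrB //; ring.
by rewrite ffact_small // !mul0r mulr0.
Qed.

Lemma inv_fact_subSS (m k : nat) :
  inv_fact_sub m.+1 k.+1 = inv_fact_sub m k.
Proof.
rewrite /inv_fact_sub ffactSS factS !natrM.
have := fact_rat_neq0 m; have : m%:R + 1 != 0 :> rat by rewrite natr1 pnatr_eq0.
by rewrite -natr1 => ? ?; field; apply/andP.
Qed.

(** Used to express the terms of smaller rank as polynomial multiples of the one of largest rank. *)
Lemma inv_fact_subSl (m k : nat) :
  inv_fact_sub m k = (m.+1%:R - k%:R) * inv_fact_sub m.+1 k.
Proof. by rewrite -inv_fact_subSS inv_fact_subSr. Qed.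

Lemma signr_addn_sub (k j : nat) :
  (j <= k)%N -> (-1) ^+ (k - j) = (-1) ^+ (k + j) :> rat.
Proof.
by move=> jk; rewrite -signr_odd oddB // -oddD signr_odd.
Qed.

(** As m - (k - j) = (m + j) - k, multiplication by ['X^j] is absorbed into the first argument. *)
Lemma inv_fact_sub_shift (m k j : nat) :
  (j <= k)%N -> inv_fact_sub m (k - j) = inv_fact_sub (m + j) k.
Proof.
move=> jk; rewrite -{2}(subnK jk); elim: j {jk} (k - j)%N => [|j IHj] i.
  by rewrite !addn0.
by rewrite !addnS inv_fact_subSS.
Qed.

(** * Coefficients of the closed forms as hypergeometric terms *)

Lemma bin_inv_fact_sub (l k : nat) :
  'C(l, k)%:R = (l`!)%:R / (k`!)%:R * inv_fact_sub l k :> rat.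
Proof.
rewrite /inv_fact_sub -bin_ffact natrM.
have := fact_rat_neq0 k; have := fact_rat_neq0 l.
by move=> ? ?; field; apply/andP.
Qed.

Lemma bin_addn_fact (m n : nat) :
  'C(m + n, m)%:R = ((m + n)`!)%:R / ((m`!)%:R * (n`!)%:R) :> rat.
Proof.
rewrite -(bin_fact (leq_addr n m)) addKn !natrM.
have := fact_rat_neq0 m; have := fact_rat_neq0 n.
by move=> ? ?; field; apply/andP.
Qed.

(** The second binomial is (l + 1 + k)! / ((k + 1)! l!); its l! and the prefactor 1 / (l + 1) cancel
    the (l + 1)! of the first. Above the degree both sides are 0. *)
Lemma coef_closedA (l k : nat) :
  (closedA l.+1)`_k =
  (-1) ^+ k * ((l.+1 + k)`!)%:R / ((k`!)%:R * (k.+1`!)%:R)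
    * inv_fact_sub l.+1 k.
Proof.
have -> : closedA l.+1 = \poly_(i < l.+2)
    ((-1) ^+ i * l.+1%:R^-1 * 'C(l.+1, i)%:R * 'C(l.+1 + i, i.+1)%:R)
  by rewrite poly_def.
rewrite coef_poly ltnS.
have [kl|lk] := leqP; last by rewrite inv_fact_sub_small // mulr0.
rewrite bin_inv_fact_sub.
have -> : (l.+1 + k = k.+1 + l)%N by lia.
rewrite bin_addn_fact (factS l) natrM.
have := fact_rat_neq0 k; have := fact_rat_neq0 l; have := fact_rat_neq0 k.+1.
have : l%:R + 1 != 0 :> rat by rewrite natr1 pnatr_eq0.
by rewrite -natr1 => ? ? ? ?; field; apply/and4P.
Qed.

Lemma coef_closedB (l k : nat) :
  (closedB l.+1)`_k =
  (-1) ^+ k * l.+1%:R * ((l + k)`!)%:R / (k`!)%:R ^+ 2 * inv_fact_sub l.+1 k.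
Proof.
have -> : closedB l.+1 = \poly_(i < l.+2)
    ((-1) ^+ i * 'C(l.+1, i)%:R * 'C(l.+1 + i - 1, i)%:R) by rewrite poly_def.
rewrite coef_poly ltnS.
have [kl|lk] := leqP; last by rewrite inv_fact_sub_small // mulr0.
rewrite bin_inv_fact_sub.
have -> : (l.+1 + k - 1 = k + l)%N by lia.
rewrite bin_addn_fact (factS l) natrM (addnC l).
have := fact_rat_neq0 k; have := fact_rat_neq0 l.
by move=> ? ?; field; apply/andP.
Qed.

(** The two products in the polynomial factor come from the two summands of the type D formula.
    Writing the rank as [l.+3] turns the upper indices into l + k + 1 and l + k, with no
    truncation. *)
Lemma coef_closedD (l k : nat) :
  let L : rat := l%:R in let K : rat := k%:R in
  (closedD l.+3)`_k =
  (-1) ^+ k * ((L + 3) * (L + 2) * (L + 1 + K) + (L + 1) * K * (K - 1))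
    * ((l + k)`!)%:R / (k`!)%:R ^+ 2 * inv_fact_sub l.+3 k.
Proof.
move=> L K; have -> : closedD l.+3 = \poly_(i < l.+4)
    ((-1) ^+ i *
     ('C(l.+3, i)%:R * 'C(l.+3 + i - 2, i)%:R
      + (if (2 <= i)%N then 'C(l.+3 - 2, i - 2)%:R else 0)
        * 'C(l.+3 + i - 3, i)%:R)) by rewrite poly_def.
rewrite coef_poly ltnS.
have [kl|lk] := leqP k l.+3; last by rewrite inv_fact_sub_small // mulr0.
have kn := fact_rat_neq0 k; have ln := fact_rat_neq0 l.
have l1n : L + 1 != 0 by rewrite natr1 pnatr_eq0.
(* The factor K (K - 1) vanishes at k = 0 and k = 1, so one formula covers both branches. *)
have -> : (if (2 <= k)%N then 'C(l.+3 - 2, k - 2)%:R else 0) =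
    K * (K - 1) * (L + 1) * (l`!)%:R / (k`!)%:R * inv_fact_sub l.+3 k :> rat.
  rewrite /K; case: k kl kn @K => [|[|k]] kl kn //=; first by rewrite !mul0r.
    by rewrite subrr mulr0 !mul0r.
  move: kn; rewrite !subSS !subn0 bin_inv_fact_sub !inv_fact_subSS !factS.
  rewrite !natrM !mulf_eq0 -!natr1 -/L.
  rewrite !negb_or => /and3P[? ? ?].
  by field; apply/and3P.
rewrite bin_inv_fact_sub.
have -> : (l.+3 + k - 2 = k + l.+1)%N by lia.
have -> : (l.+3 + k - 3 = k + l)%N by lia.
rewrite !bin_addn_fact addnS !factS !natrM (addnC l) -!natr1 natrD -/L -/K.
by field; rewrite kn ln l1n.
Qed.

(** * Coefficients of the closed forms multiplied by a power of the variable *)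

(* The rank is shifted along with the exponent, so that the factorial is
   (l + k)! for every j: no truncated difference k - j is left. *)
Lemma coef_Xn_closedA (l j k : nat) :
  ('X^j * closedA (l + j).+1)`_k =
  (-1) ^+ (k + j) * ((l + k).+1`!)%:R * inv_fact_sub k j
    * inv_fact_sub k.+1 j * inv_fact_sub (l + j + j).+1 k.
Proof.
rewrite coefXnM; case: ltnP => [kj|jk].
  (* The zero comes from 1 / (k - j)!; the other factor 1 / (k + 1 - j)! is still 1 at j = k + 1. *)
  by rewrite (inv_fact_sub_small kj) mulr0 !mul0r.
rewrite coef_closedA inv_fact_sub_shift // signr_addn_sub //.
rewrite (inv_fact_subE jk) (inv_fact_subE (leqW jk)) subSn // invfM.
by rewrite !addSn -addnA subnKC //; ring.
Qed.

Lemma coef_Xn_closedB (l j k : nat) :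
  ('X^j * closedB (l + j).+1)`_k =
  (-1) ^+ (k + j) * (l + j).+1%:R * ((l + k)`!)%:R * inv_fact_sub k j ^+ 2
    * inv_fact_sub (l + j + j).+1 k.
Proof.
rewrite coefXnM; case: ltnP => [kj|jk].
  by rewrite (inv_fact_sub_small kj) expr0n mulr0 !mul0r.
rewrite coef_closedB inv_fact_sub_shift // signr_addn_sub //.
by rewrite (inv_fact_subE jk) -exprVn addSn -[(l + j + _)%N]addnA subnKC.
Qed.

Lemma coef_Xn_closedD (l j k : nat) :
  let L : rat := (l + j)%:R in let K : rat := k%:R - j%:R in
  ('X^j * closedD (l + j).+3)`_k =
  (-1) ^+ (k + j) * ((L + 3) * (L + 2) * (L + 1 + K) + (L + 1) * K * (K - 1))
    * ((l + k)`!)%:R * inv_fact_sub k j ^+ 2 * inv_fact_sub (l + j + j).+3 k.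
Proof.
move=> L K; rewrite coefXnM; case: ltnP => [kj|jk].
  by rewrite (inv_fact_sub_small kj) expr0n mulr0 !mul0r.
rewrite coef_closedD inv_fact_sub_shift // signr_addn_sub //.
by rewrite (inv_fact_subE jk) -exprVn natrB // -[(l + j + _)%N]addnA subnKC.
Qed.

(** * The recurrences for the closed forms *)

Lemma closedA_rec (l : nat) :
  (l.+1 + 3)%:R *: closedA l.+3 =
    - ((2 * l.+1 + 3)%:R *: ((2 *: 'X - 1) * closedA l.+2))
    - l.+1%:R *: closedA l.+1.
Proof.
rewrite !(natrD, natrM); apply/polyP => k; have kn := fact_rat_neq0 k.
have k1n : k%:R + 1 != 0 :> rat by rewrite natr1 pnatr_eq0.
have := coef_Xn_closedA l.+2 0 k; have := coef_Xn_closedA l.+1 0 k.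
have := coef_Xn_closedA l 0 k; have := coef_Xn_closedA l 1 k.
rewrite !addn0 !addn1 expr1 expr0 !mul1r => XA1 A0 A1 A2.
rewrite mulrBl mul1r -scalerAl !(coefB, coefN, coefZ) XA1 A0 A1 A2.
(* Here 1 / (k - 1)! becomes k / k!, also for k = 0. The next rewrites bring every rank to
   [inv_fact_sub l.+3 k] and every numerator to (l + k)!, leaving a rational identity in l and k. *)
rewrite inv_fact_subSS inv_fact_subSr !inv_fact_sub0.
rewrite (inv_fact_subSl l.+1) (inv_fact_subSl l.+2) !addSn !factS !natrM.
rewrite (exprSr _ k) -!natr1.
by field; rewrite kn k1n.
Qed.

Lemma closedB_rec (l : nat) :
  l.+3%:R *: closedB l.+3 =
    - ((2 * l.+1 + 3)%:R *:
         ((2 *: 'X - ((2 * (2 * l.+1 ^ 2 + 4 * l.+1 + 1))%:R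
                      / ((2 * l.+1 + 1) * (2 * l.+1 + 3))%:R)%:P)
          * closedB l.+2))
    - ((l.+1 * (2 * l.+1 + 3))%:R / (2 * l.+1 + 1)%:R) *: closedB l.+1.
Proof.
rewrite expnS expn1 !(natrD, natrM); apply/polyP => k; have kn := fact_rat_neq0 k.
have l1n : 2 * (l%:R + 1) + 1 != 0 :> rat by rewrite natr1 -natrM natr1 pnatr_eq0.
have l3n : 2 * (l%:R + 1) + 3 != 0 :> rat.
  by rewrite natr1 -natrM -natrD pnatr_eq0 addnS.
have := coef_Xn_closedB l.+2 0 k; have := coef_Xn_closedB l.+1 0 k.
have := coef_Xn_closedB l 0 k; have := coef_Xn_closedB l 1 k.
rewrite !addn0 !addn1 expr1 expr0 !mul1r => XB1 B0 B1 B2.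
rewrite mulrBl -scalerAl !(coefB, coefN, coefZ, coefCM) XB1 B0 B1 B2.
rewrite inv_fact_subSr !inv_fact_sub0.
rewrite (inv_fact_subSl l.+1) (inv_fact_subSl l.+2) !addSn !factS !natrM.
rewrite (exprSr _ k) -!natr1.
by field; rewrite kn l1n l3n.
Qed.

Lemma Qcoef_neq0 (l : nat) : Qcoef l.+4%:R != 0.
Proof.
rewrite /Qcoef -[l.+4]addn4 natrD; move: l%:R (ler0n rat l) => x x0.
have x20 := exprn_ge0 2 x0; have x30 := exprn_ge0 3 x0.
apply: mulf_neq0; apply: lt0r_neq0; first by lra.
(* Expanded around 4, the cubic has only positive coefficients. *)
have -> : 43 * (x + 4) ^+ 3 - 35 * (x + 4) ^+ 2 - 36 * (x + 4) - 32 =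
    43 * x ^+ 3 + 481 * x ^+ 2 + 1748 * x + 2016 by ring.
by lra.
Qed.

Lemma closedD_rec (l : nat) :
  let L : rat := l.+4%:R in
  closedD l.+4.+3 =
    ((acoef L)%:P + bcoef L *: 'X) * closedD l.+3.+3
    + ((ccoef L)%:P + dcoef L *: 'X + ecoef L *: 'X^2) * closedD l.+2.+3
    + ((fcoef L)%:P + gcoef L *: 'X) * closedD l.+1.+3.
Proof.
move=> L; have Qn : Qcoef L != 0 by exact: Qcoef_neq0.
apply/polyP => k; have kn := fact_rat_neq0 k.
have := coef_Xn_closedD l.+4 0 k; have := coef_Xn_closedD l.+3 0 k.
have := coef_Xn_closedD l.+2 0 k; have := coef_Xn_closedD l.+1 0 k.
have := coef_Xn_closedD l.+2 1 k; have := coef_Xn_closedD l.+1 1 k.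
have := coef_Xn_closedD l 1 k; have := coef_Xn_closedD l 2 k.
rewrite !addn0 !addn1 !addn2 expr1 expr0 !mul1r => X2D1 XD0 XD1 XD2 D0 D1 D2 D3.
rewrite !mulrDl -!scalerAl !(coefD, coefN, coefZ, coefCM).
rewrite X2D1 XD0 XD1 XD2 D0 D1 D2 D3.
(* All eight terms now reduce to multiples of (l + k)! / k!^2 times [inv_fact_sub l.+4.+3 k]; the
   square of 1 / (k - 2)! contributes (k (k - 1))^2. *)
rewrite !inv_fact_subSr !inv_fact_sub0.
rewrite (inv_fact_subSl l.+4) (inv_fact_subSl l.+4.+1) (inv_fact_subSl l.+4.+2).
rewrite !addSn !factS !natrM.
have LE : L = l%:R + 4 by rewrite /L -[l.+4]addn4 natrD.
rewrite (exprSr _ k.+1) (exprSr _ k) -!natr1 !natrD.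
rewrite /acoef /bcoef /ccoef /dcoef /ecoef /fcoef /gcoef.
move: Qn; rewrite /Qcoef LE mulf_eq0 negb_or => /andP[Q1 Q2].
by field; rewrite kn Q1 Q2.
Qed.

Theorem theorem3p1
  (cA : forall l : nat, coxeter_group (coxeterA l))
  (cB : forall l : nat, coxeter_group (coxeterB l))
  (cD : forall l : nat, coxeter_group (coxeterD l))
  (bipA : forall l : nat, (1 <= l)%N -> bipartite_coxeter_element (cA l))
  (bipB : forall l : nat, (2 <= l)%N -> bipartite_coxeter_element (cB l))
  (bipD : forall l : nat, (4 <= l)%N -> bipartite_coxeter_element (cD l))
  (knownA : forall l : nat, (1 <= l)%N -> skew_growth (cA l) = closedA l)
  (knownB : forall l : nat, (2 <= l)%N -> skew_growth (cB l) = closedB l)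
  (knownD : forall l : nat, (4 <= l)%N -> skew_growth (cD l) = closedD l) :
  let NA l := skew_growth (cA l) in
  let NB l := skew_growth (cB l) in
  let ND l := skew_growth (cD l) in
  [/\ forall l : nat, (1 <= l)%N ->
        (l + 3)%:R *: NA (l + 2)%N =
          - ((2 * l + 3)%:R *: ((2 *: 'X - 1) * NA (l + 1)%N)) - l%:R *: NA l,
      forall l : nat, (2 <= l)%N ->
        (l + 2)%:R *: NB (l + 2)%N =
          - ((2 * l + 3)%:R *:
               ((2 *: 'X - ((2 * (2 * l ^ 2 + 4 * l + 1))%:R
                            / ((2 * l + 1) * (2 * l + 3))%:R)%:P)
                * NB (l + 1)%N))
          - ((l * (2 * l + 3))%:R / (2 * l + 1)%:R) *: NB l
    & forall l : nat, (4 <= l)%N ->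
        let L : rat := l%:R in
        ND (l + 3)%N =
          ((acoef L)%:P + bcoef L *: 'X) * ND (l + 2)%N
          + ((ccoef L)%:P + dcoef L *: 'X + ecoef L *: 'X^2) * ND (l + 1)%N
          + ((fcoef L)%:P + gcoef L *: 'X) * ND l ].
Proof.
(* The ranks are rewritten as successors to match the truncation-free indexing of the
   recurrences. *)
move=> NA NB ND; split=> [[//|l] _|[//|l] l1|[|[|[|[//|l]]]] // _].
- by rewrite /NA addn1 addn2 !knownA // closedA_rec.
- by rewrite /NB (addn1 l.+1) addn2 !knownB // closedB_rec.
- move=> L; rewrite /ND addn1 addn2 addn3 !knownD //; exact: closedD_rec.
Qed.
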